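(* Let $\alpha,\beta\in\mathbb{R}$, $\eta\in\{1,-1\}$, and let $G_4$ be the connected, simply connected three-dimensional Lie group with left-invariant Lorentzian metric $g$ whose Lie algebra has a pseudo-orthonormal basis $\{\widetilde e_1,\widetilde e_2,\widetilde e_3\}$, with $\widetilde e_3$ timelike, satisfying $$[\widetilde e_1,\widetilde e_2]=-\widetilde e_2+(2\eta-\beta)\widetilde e_3,\quad [\widetilde e_1,\widetilde e_3]=-\beta\widetilde e_2+\widetilde e_3,\quad [\widetilde e_2,\widetilde e_3]=\alpha\widetilde e_1.$$ Then the symmetrized Ricci tensor $\widetilde\rho^B$ of the Bott connection $\nabla^B$ is a Codazzi tensor on $(G_4,\nabla^B)$ if and only if $\alpha=\beta=0$.
   Context: Basis vectors are identified with left-invariant vector fields on the group $G$; $g(\widetilde e_1,\widetilde e_1)=g(\widetilde e_2,\widetilde e_2)=1$, $g(\widetilde e_3,\widetilde e_3)=-1$, and $g(\widetilde e_i,\widetilde e_j)=0$ for $i\ne j$. Let $\nabla^L$ be the Levi-Civita connection of $g$, $D=\mathrm{span}\{\widetilde e_1,\widetilde e_2\}$, $D^\perp=\mathrm{span}\{\widetilde e_3\}$ (distributions on $G$), with associated projections $\pi_D,\pi_{D^\perp}$ of $TG=D\oplus D^\perp$. The Bott connection $\nabla^B$ is the linear connection given by: $\nabla^B_XY=\pi_D(\nabla^L_XY)$ for $X,Y\in\Gamma^\infty(D)$; $\nabla^B_XY=\pi_D([X,Y])$ for $X\in\Gamma^\infty(D^\perp),Y\in\Gamma^\infty(D)$;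 $\nabla^B_XY=\pi_{D^\perp}([X,Y])$ for $X\in\Gamma^\infty(D),Y\in\Gamma^\infty(D^\perp)$; $\nabla^B_XY=\pi_{D^\perp}(\nabla^L_XY)$ for $X,Y\in\Gamma^\infty(D^\perp)$. Curvature: $R^B(X,Y)Z=\nabla^B_X\nabla^B_YZ-\nabla^B_Y\nabla^B_XZ-\nabla^B_{[X,Y]}Z$. Ricci tensor: $\rho^B(X,Y)=-g(R^B(X,\widetilde e_1)Y,\widetilde e_1)-g(R^B(X,\widetilde e_2)Y,\widetilde e_2)+g(R^B(X,\widetilde e_3)Y,\widetilde e_3)$. Symmetrized Ricci tensor: $\widetilde\rho^B(X,Y)=\tfrac12(\rho^B(X,Y)+\rho^B(Y,X))$. For a linear connection $\nabla$ and a $(0,2)$ tensor field $\omega$: $(\nabla_X\omega)(Y,Z)=X[\omega(Y,Z)]-\omega(\nabla_XY,Z)-\omega(Y,\nabla_XZ)$. The tensor $\omega$ is called a Codazzi tensor on $(G,\nabla)$ if $(\nabla_X\omega)(Y,Z)-(\nabla_Y\omega)(X,Z)=0$ for all vector fields $X,Y,Z$. *)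

(* Defs.v *)
From HB Require Import structures.
From mathcomp Require Import all_boot all_order all_algebra.
From mathcomp Require Import all_classical all_reals all_analysis.

Set Implicit Arguments.
Unset Strict Implicit.
Unset Printing Implicit Defensive.

Import Order.TTheory GRing.Theory Num.Theory.
Import numFieldNormedType.Exports.

Local Open Scope classical_set_scope.
Local Open Scope ring_scope.

(* [U] is meant to be open and [V] finite-dimensional; asking for the
   directional derivatives in all directions is then the same as asking for
   the partial derivatives. *)
Fixpoint Ck_on (R : realType) (V W : normedModType R) (k : nat)
    (U : set V) (f : V -> W) : Prop :=
  (forall x, U x -> {for x, continuous f}) /\
  if k is k'.+1 then
    forall v, (forall x, U x -> derivable f x v) /\
              Ck_on k' U (fun x => 'D_v f x)
  else True.

Definition smooth_on (R : realType) (V W : normedModType R)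
    (U : set V) (f : V -> W) : Prop :=
  forall k, Ck_on k U f.

(* [chart_map] is meaningful only on [chart_dom], and [chart_inv] only on
   [chart_cod], where it is the inverse of [chart_map]. *)
Record chart (R : realType) (n : nat) (M : Type) := Chart {
  chart_dom : set M ;
  chart_map : M -> 'rV[R]_n ;
  chart_inv : 'rV[R]_n -> M }.

Definition chart_cod (R : realType) (n : nat) (M : Type)
    (c : chart R n M) : set 'rV[R]_n := chart_map c @` chart_dom c.

Definition is_chart (R : realType) (n : nat) (M : topologicalType)
    (c : chart R n M) : Prop :=
  [/\ open (chart_dom c), open (chart_cod c),
      (forall p, chart_dom c p -> chart_inv c (chart_map c p) = p),
      (forall p, chart_dom c p -> {for p, continuous (chart_map c)}) &
      (forall x, chart_cod c x -> {for x, continuous (chart_inv c)})].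

Definition smooth_atlas (R : realType) (n : nat) (M : topologicalType)
    (A : set (chart R n M)) : Prop :=
  [/\ (forall c, A c -> is_chart c),
      (forall p, exists2 c, A c & chart_dom c p) &
      (forall c d, A c -> A d ->
         smooth_on (chart_map c @` (chart_dom c `&` chart_dom d))
                   (chart_map d \o chart_inv c))].

HB.mixin Record isManifold (R : realType) (n : nat) M of Topological M := {
  atlas : set (chart R n M) ;
  atlas_smooth : smooth_atlas atlas ;
  manifold_hausdorff : hausdorff_space M ;
  manifold_second_countable : @second_countable M }.

#[short(type="manifoldType")]
HB.structure Definition Manifold (R : realType) (n : nat) :=
  { M of isManifold R n M & Topological M }.

HB.mixin Record isLieGroup (R : realType) (n : nat) G
    of Manifold R n G & Group G := {
  mul_continuous : continuous (fun z : G * G => (z.1 * z.2)%g) ;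
  mul_smooth : forall c1 c2 d : chart R n G,
    atlas c1 -> atlas c2 -> atlas d ->
    smooth_on
      [set w : 'rV[R]_n * 'rV[R]_n |
         [/\ chart_cod c1 w.1, chart_cod c2 w.2 &
             chart_dom d (chart_inv c1 w.1 * chart_inv c2 w.2)%g]]
      (fun w => chart_map d (chart_inv c1 w.1 * chart_inv c2 w.2)%g) ;
  inv_continuous : continuous (fun p : G => p^-1%g) ;
  inv_smooth : forall c d : chart R n G, atlas c -> atlas d ->
    smooth_on [set x | chart_cod c x /\ chart_dom d (chart_inv c x)^-1%g]
              (fun x => chart_map d (chart_inv c x)^-1%g) }.

#[short(type="lieGroupType")]
HB.structure Definition LieGroup (R : realType) (n : nat) :=
  { G of isLieGroup R n G & Manifold R n G & Group G }.

Definition simply_connected (R : realType) (T : topologicalType) : Prop :=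
  (forall p q : T, exists gamma : R -> T,
     [/\ {within `[0, 1], continuous gamma}, gamma 0 = p & gamma 1 = q]) /\
  (forall gamma : R -> T,
     {within `[0, 1], continuous gamma} -> gamma 0 = gamma 1 ->
     exists H : R * R -> T,
       [/\ {within `[0, 1] `*` `[0, 1], continuous H},
           (forall s, s \in `[0, 1] -> H (s, 0) = gamma s),
           (forall s, s \in `[0, 1] -> H (s, 1) = gamma 0) &
           (forall t, t \in `[0, 1] -> H (0, t) = gamma 0 /\
                                       H (1, t) = gamma 0)]).

Definition smooth_fun (R : realType) (n : nat) (M : manifoldType R n)
    (f : M -> R) : Prop :=
  forall c : chart R n M, atlas c -> smooth_on (chart_cod c) (f \o chart_inv c).

(* Vector fields are encoded by the operators through which they act on
   functions; addition and real scaling of operators are the pointwise ones of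
   the library. *)
Notation operator M R := ((M -> R) -> M -> R).

(* The operator reads [\sum_i a^i d/dx^i] in every chart, with smooth
   components [a^i]. It is only meant to act on smooth functions: requiring
   the value 0 on the other ones makes equality of vector fields coincide
   with Leibniz equality. *)
Definition vector_field (R : realType) (n : nat) (M : manifoldType R n)
    (X : operator M R) : Prop :=
  (forall f, ~ smooth_fun f -> X f = cst 0) /\
  (forall c : chart R n M, atlas c ->
     exists2 a : 'rV[R]_n -> 'rV[R]_n, smooth_on (chart_cod c) a &
       forall f, smooth_fun f -> forall x, chart_cod c x ->
         X f (chart_inv c x) =
         \sum_(i < n) a x 0 i * 'D_(delta_mx 0 i) (f \o chart_inv c) x).

Definition fscale (R : realType) (M : Type) (h : M -> R) (X : operator M R) :
  operator M R := fun f p => h p * X f p.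

Definition bracket (R : realType) (M : Type) (X Y : operator M R) :
  operator M R := fun f => X (Y f) - Y (X f).

Definition span1 (R : realType) (n : nat) (M : manifoldType R n)
    (E X : operator M R) : Prop :=
  exists2 h : M -> R, smooth_fun h & X = fscale h E.

Definition span2 (R : realType) (n : nat) (M : manifoldType R n)
    (E1 E2 X : operator M R) : Prop :=
  exists h1 h2 : M -> R, [/\ smooth_fun h1, smooth_fun h2 &
    X = fscale h1 E1 + fscale h2 E2].

(* [D] and [D'] are the spaces of sections of two distributions, and [piD],
   [piD'] the projections of a direct sum decomposition of the tangent
   bundle. *)
Definition projections (R : realType) (n : nat) (M : manifoldType R n)
    (D D' : operator M R -> Prop) (piD piD' : operator M R -> operator M R) :
    Prop :=
  (forall X, D X -> D' X -> X = 0) /\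
  (forall X, vector_field X ->
     [/\ D (piD X), D' (piD' X) & X = piD X + piD' X]).

Definition linear_connection (R : realType) (n : nat) (M : manifoldType R n)
    (nabla : operator M R -> operator M R -> operator M R) : Prop :=
  forall X X' Y Y' : operator M R, vector_field X -> vector_field X' ->
    vector_field Y -> vector_field Y' ->
  [/\ vector_field (nabla X Y),
      nabla (X + X') Y = nabla X Y + nabla X' Y,
      nabla X (Y + Y') = nabla X Y + nabla X Y' &
      forall h : M -> R, smooth_fun h ->
        nabla (fscale h X) Y = fscale h (nabla X Y) /\
        nabla X (fscale h Y) = fscale (X h) Y + fscale h (nabla X Y)].

Definition orthonormal_at (R : realType) (M : Type)
    (g : operator M R -> operator M R -> M -> R) (E1 E2 E3 : operator M R)
    (p : M) : Prop :=
  [/\ g E1 E1 p = 1, g E2 E2 p = 1 & g E3 E3 p = -1] /\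
  [/\ g E1 E2 p = 0, g E1 E3 p = 0 & g E2 E3 p = 0].

(* In dimension 3, the last clause says that [g] has signature (+, +, -) at
   every point. *)
Definition lorentzian_metric (R : realType) (M : manifoldType R 3)
    (g : operator M R -> operator M R -> M -> R) : Prop :=
  (forall X X' Y : operator M R, vector_field X -> vector_field X' ->
     vector_field Y ->
     [/\ smooth_fun (g X Y), g X Y = g Y X,
         g (X + X') Y = g X Y + g X' Y &
         forall h : M -> R, smooth_fun h -> g (fscale h X) Y = h * g X Y]) /\
  (forall p, exists E1 E2 E3 : operator M R,
     [/\ vector_field E1, vector_field E2 & vector_field E3] /\
     orthonormal_at g E1 E2 E3 p).

Definition levi_civita (R : realType) (n : nat) (M : manifoldType R n)
    (g : operator M R -> operator M R -> M -> R)
    (nabla : operator M R -> operator M R -> operator M R) : Prop :=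
  [/\ linear_connection nabla,
      (forall X Y : operator M R, vector_field X -> vector_field Y ->
         nabla X Y - nabla Y X = bracket X Y) &
      (forall X Y Z : operator M R, vector_field X -> vector_field Y ->
         vector_field Z ->
         X (g Y Z) = g (nabla X Y) Z + g Y (nabla X Z))].

Definition bott_connection (R : realType) (n : nat) (M : manifoldType R n)
    (D D' : operator M R -> Prop) (piD piD' : operator M R -> operator M R)
    (nablaL nablaB : operator M R -> operator M R -> operator M R) : Prop :=
  [/\ linear_connection nablaB,
      (forall X Y, D X -> D Y -> nablaB X Y = piD (nablaL X Y)),
      (forall X Y, D' X -> D Y -> nablaB X Y = piD (bracket X Y)),
      (forall X Y, D X -> D' Y -> nablaB X Y = piD' (bracket X Y)) &
      (forall X Y, D' X -> D' Y -> nablaB X Y = piD' (nablaL X Y))].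

Definition curvature (R : realType) (M : Type)
    (nabla : operator M R -> operator M R -> operator M R)
    (X Y Z : operator M R) : operator M R :=
  nabla X (nabla Y Z) - nabla Y (nabla X Z) - nabla (bracket X Y) Z.

Definition ricci (R : realType) (M : Type)
    (g : operator M R -> operator M R -> M -> R)
    (nabla : operator M R -> operator M R -> operator M R)
    (e1 e2 e3 X Y : operator M R) : M -> R :=
  - g (curvature nabla X e1 Y) e1 - g (curvature nabla X e2 Y) e2
  + g (curvature nabla X e3 Y) e3.

Definition sym_ricci (R : realType) (M : Type)
    (g : operator M R -> operator M R -> M -> R)
    (nabla : operator M R -> operator M R -> operator M R)
    (e1 e2 e3 X Y : operator M R) : M -> R :=
  fun p => (ricci g nabla e1 e2 e3 X Y p + ricci g nabla e1 e2 e3 Y X p) / 2.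

Definition cov_deriv (R : realType) (M : Type)
    (nabla : operator M R -> operator M R -> operator M R)
    (omega : operator M R -> operator M R -> M -> R)
    (X Y Z : operator M R) : M -> R :=
  X (omega Y Z) - omega (nabla X Y) Z - omega Y (nabla X Z).

Definition codazzi (R : realType) (n : nat) (M : manifoldType R n)
    (nabla : operator M R -> operator M R -> operator M R)
    (omega : operator M R -> operator M R -> M -> R) : Prop :=
  forall X Y Z : operator M R,
    vector_field X -> vector_field Y -> vector_field Z ->
    cov_deriv nabla omega X Y Z - cov_deriv nabla omega Y X Z = 0.

(* Push-forward of [X] by the left translation by [a]. *)
Definition translate (R : realType) (G : groupType) (a : G)
    (X : operator G R) : operator G R :=
  fun f p => X (fun q => f (a * q)%g) (a^-1 * p)%g.

Definition left_invariant (R : realType) (G : groupType)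
    (X : operator G R) : Prop := forall a, translate a X = X.

Definition left_invariant_metric (R : realType) (n : nat)
    (G : lieGroupType R n) (g : operator G R -> operator G R -> G -> R) :
    Prop :=
  forall (a : G) (X Y : operator G R), vector_field X -> vector_field Y ->
  forall p, g (translate a X) (translate a Y) (a * p)%g = g X Y p.

Definition lie_algebra_basis (R : realType) (G : lieGroupType R 3)
    (e1 e2 e3 : operator G R) : Prop :=
  [/\ vector_field e1 /\ left_invariant e1,
      vector_field e2 /\ left_invariant e2,
      vector_field e3 /\ left_invariant e3 &
      forall X : operator G R, vector_field X -> left_invariant X ->
        exists! c : R * R * R,
          X = c.1.1 *: e1 + c.1.2 *: e2 + c.2 *: e3].

(* Main.v *)
From HB Require Import structures.
Require Import Defs.
From mathcomp Require Import all_boot all_order all_algebra.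
From mathcomp Require Import all_classical all_reals all_analysis.
From mathcomp Require Import ring lra.

Import GRing.Theory.
Import numFieldNormedType.Exports.
Local Open Scope classical_set_scope.
Local Open Scope ring_scope.

Set Implicit Arguments.
Unset Strict Implicit.
Unset Printing Implicit Defensive.

(** Both [sym_ricci] and its covariant derivative are tensors, so the Codazzi
    equation is decided by its values on the left-invariant frame
    [e1, e2, e3], on which everything has constant coefficients.

    Write [gamma = 2 * eta - beta]. The Koszul argument (metric compatibility
    and vanishing torsion) determines the components of the Levi-Civita
    connection in the plane [D], and with the brackets it gives the Bott
    connection on constant combinations of the frame ([bott_comb]):
      [nabla_x y = (- a y2, b y1, x1 y3)],
    where [a = x2 + alpha x3] and [b = x2 + beta x3]. The curvature and the
    Ricci tensor follow ([curvature_comb], [ricci_comb]), and the symmetrized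
    Ricci tensor has matrix
      [(beta gamma - 1, 0, 0; 0, alpha gamma - 1, alpha / 2; 0, alpha / 2, 0)].
    The Codazzi equation on [(e1, e3, e2)] says [alpha / 2 - beta = 0], and on
    [(e1, e3, e3)] it says [alpha beta / 2 = 0]; together they force
    [alpha = beta = 0]. Conversely, for [alpha = beta = 0] the symmetrized
    Ricci tensor is minus the metric of [D] and [nabla] acts on [D] by
    infinitesimal rotations, so that this tensor is even parallel; parallelism
    passes from the frame to all vector fields because [cov_deriv] is linear
    over smooth functions in each argument ([frame_ind]).

    Vector fields being operators on functions, linearity over smooth
    functions has to be earned: a vector field maps smooth functions to smooth
    functions ([vf_smooth]) and obeys the Leibniz rule ([vf_actM]), both of
    which rest on a calculus of [C^k] functions on open sets. That the bracket
    of two vector fields is again a vector field is read off from the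
    torsion-free connection ([bracket_vf]), which avoids the symmetry of second
    derivatives. *)

(** * Calculus of C^k functions on an open set *)

Section CkCalculus.
Variables (R : realType) (V : normedModType R) (U : set V).
Hypothesis oU : open U.

Lemma near_open (W : Type) (f g : V -> W) x :
  {in U, f =1 g} -> U x -> \near x, f x = g x.
Proof.
move=> fg Ux; have Unbhs : nbhs x U by apply: open_nbhs_nbhs.
by near=> y; apply/fg/mem_set; near: y.
Unshelve. all: by end_near. Qed.

Lemma Ck_on_ext (W : normedModType R) k (f g : V -> W) :
  {in U, f =1 g} -> Ck_on k U f -> Ck_on k U g.
Proof.
elim: k f g => [|k IH] f g fg /= [cf df];
  (split; first (move=> x Ux; have fgx := near_open fg Ux;
     rewrite /prop_for /continuous_at -(fg x (mem_set Ux));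
     exact: cvg_trans (near_eq_cvg fgx) (cf x Ux))) => // v.
have [dfv ckf] := df v; split=> [x Ux|].
  exact: near_eq_derivable (near_open fg Ux) (dfv x Ux).
apply: IH ckf => x /set_mem Ux.
exact/near_eq_derive/near_open.
Qed.

Lemma Ck_on_pred (W : normedModType R) k (f : V -> W) :
  Ck_on k.+1 U f -> Ck_on k U f.
Proof.
elim: k f => [|k IH] f [cf df]; split=> // v.
by have [dfv ckf] := df v; split=> //; apply: IH.
Qed.

Lemma Ck_on_cst (W : normedModType R) k (w : W) : Ck_on k U (fun=> w).
Proof.
elim: k w => [|k IH] w; (split; first by move=> x _; exact: cvg_cst) => // v.
split=> [x _|]; first exact: derivable_cst.
by apply: Ck_on_ext (IH 0) => x _; rewrite derive_cst.
Qed.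

Lemma Ck_onD (W : normedModType R) k (f g : V -> W) :
  Ck_on k U f -> Ck_on k U g -> Ck_on k U (fun x => f x + g x).
Proof.
elim: k f g => [|k IH] f g [cf df] [cg dg];
  (split; first by move=> x Ux; apply: cvgD; [exact: cf|exact: cg]) => // v.
have [dfv ckf] := df v; have [dgv ckg] := dg v.
split=> [x Ux|]; first by apply: derivableD; [exact: dfv|exact: dgv].
apply: Ck_on_ext (IH _ _ ckf ckg) => x /set_mem Ux.
by rewrite -deriveD; [|exact: dfv|exact: dgv].
Qed.

(** The components of a vector field form one row vector, which is multiplied by
    a function as a whole: hence a product rule for scaling. *)
Lemma is_deriveZf (W : normedModType R) (f : V -> R) (g : V -> W) x v :
  derivable f x v -> derivable g x v ->
  is_derive x v (fun y => f y *: g y) (f x *: 'D_v g x + 'D_v f x *: g x).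
Proof.
move=> df dg.
have fgcvg : (fun h => h^-1 *: (((fun y => f y *: g y) \o shift x) (h *: v)
     - f x *: g x)) @ 0^' --> f x *: 'D_v g x + 'D_v f x *: g x.
  (* the difference quotient of a product, split in the usual way *)
  have -> : (fun h => h^-1 *: (((fun y => f y *: g y) \o shift x) (h *: v)
     - f x *: g x)) =
    (fun h => f (h *: v + x) *: (h^-1 *: ((g \o shift x) (h *: v) - g x))
     + (h^-1 *: ((f \o shift x) (h *: v) - f x)) *: g x).
    apply/funext => h /=; rewrite scalerA [f _ * _]mulrC -scalerA.
    rewrite -scalerA -scalerDr; congr (_ *: _).
    by rewrite scalerBr scalerBl addrA subrK.
  apply: cvgD; last exact: cvgZr_tmp df.
  apply: cvgZ; last exact: dg.
  (* [f] is continuous along the line through [x] directed by [v] *)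
  suff : {for 0, continuous (fun h : R => f(h *: v + x))}.
    by move=> /continuous_withinNx; rewrite scale0r add0r.
  exact/differentiable_continuous/derivable1_diffP/(derivable1P _ _ _).1.
split; last exact: cvg_lim fgcvg.
by apply/cvg_ex; exists (f x *: 'D_v g x + 'D_v f x *: g x).
Qed.

Lemma Ck_onZ (W : normedModType R) k (f : V -> R) (g : V -> W) :
  Ck_on k U f -> Ck_on k U g -> Ck_on k U (fun x => f x *: g x).
Proof.
elim: k f g => [|k IH] f g; first by
  move=> [cf _] [cg _]; split=> // x Ux; apply: cvgZ; [exact: cf|exact: cg].
move=> ckf ckg; have [cf df] := ckf; have [cg dg] := ckg; split.
  by move=> x Ux; apply: cvgZ; [exact: cf|exact: cg].
move=> v; have [dfv ckDf] := df v; have [dgv ckDg] := dg v.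
split=> [x Ux|].
  by case: (is_deriveZf (dfv x Ux) (dgv x Ux)).
apply: Ck_on_ext (Ck_onD (IH _ _ (Ck_on_pred ckf) ckDg)
  (IH _ _ ckDf (Ck_on_pred ckg))) => x /set_mem Ux.
by case: (is_deriveZf (dfv x Ux) (dgv x Ux)).
Qed.

Lemma Ck_on_lin (W W' : normedModType R) (L : {linear W -> W'}) k (f : V -> W) :
  continuous L -> Ck_on k U f -> Ck_on k U (L \o f).
Proof.
move=> cL; elim: k f => [|k IH] f [cf df];
  (split; first by move=> x Ux; apply: continuous_comp;
     [exact: cf|exact: cL]) => // v.
have [dfv ckf] := df v.
have Lcvg x : U x -> (fun h => h^-1 *: (((L \o f) \o shift x) (h *: v)
     - (L \o f) x)) @ 0^' --> L ('D_v f x).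
  move=> Ux.
  have -> : (fun h => h^-1 *: (((L \o f) \o shift x) (h *: v) - (L \o f) x)) =
    L \o (fun h => h^-1 *: ((f \o shift x) (h *: v) - f x)).
    apply/funext => h /=; rewrite linearZ_LR; congr (_ *: _).
    by rewrite linearB.
  have dfx :
    (fun h => h^-1 *: ((f \o shift x) (h *: v) - f x)) @ 0^' --> 'D_v f x.
    by exact: dfv.
  exact: (cvg_comp _ _ dfx (cL _)).
split=> [x Ux|].
  by apply/cvg_ex; exists (L ('D_v f x)); exact: Lcvg.
apply: Ck_on_ext (IH _ ckf) => x /set_mem Ux.
by apply/esym/cvg_lim => //; exact: Lcvg.
Qed.

Lemma Ck_on_sum (W : normedModType R) k (I : Type) (s : seq I)
    (f : I -> V -> W) :
  (forall i, Ck_on k U (f i)) -> Ck_on k U (fun x => \sum_(i <- s) f i x).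
Proof.
move=> ckf; elim: s => [|i s IH].
  by apply: Ck_on_ext (Ck_on_cst k 0) => x _; rewrite big_nil.
by apply: Ck_on_ext (Ck_onD (ckf i) IH) => x _; rewrite big_cons.
Qed.

End CkCalculus.

(** * Smooth functions and vector fields on a manifold *)

Section SmoothFunctions.
Variables (R : realType) (n : nat) (M : manifoldType R n).
Implicit Types (f h : M -> R) (c : chart R n M).

Lemma atlas_chart c : atlas c -> is_chart c.
Proof. by have [chartA _ _] := @atlas_smooth R n M; exact: chartA. Qed.

Lemma open_chart_cod c : atlas c -> open (chart_cod c).
Proof. by move=> /atlas_chart[]. Qed.

Lemma smooth_cst (r : R) : smooth_fun (cst r : M -> R).
Proof. by move=> c Ac k; exact (Ck_on_cst (open_chart_cod Ac) k r). Qed.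

Lemma smoothD f h : smooth_fun f -> smooth_fun h -> smooth_fun (f + h).
Proof.
move=> sf sh c Ac k.
exact (Ck_onD (open_chart_cod Ac) (sf c Ac k) (sh c Ac k)).
Qed.

Lemma smoothM f h : smooth_fun f -> smooth_fun h -> smooth_fun (f * h).
Proof.
move=> sf sh c Ac k.
exact (Ck_onZ (open_chart_cod Ac) (sf c Ac k) (sh c Ac k)).
Qed.

Lemma smoothN f : smooth_fun f -> smooth_fun (- f).
Proof.
move=> sf; rewrite (_ : - f = cst (-1) * f); last first.
  by apply/funext => p; rewrite /GRing.mul /= mulN1r.
by apply: smoothM => //; exact: smooth_cst.
Qed.

Lemma smooth_derivable f c x v :
  smooth_fun f -> atlas c -> chart_cod c x -> derivable (f \o chart_inv c) x v.
Proof. by move=> sf Ac cx; have [_ df] := sf c Ac 1%N; exact: (df v).1. Qed.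

Lemma in_chart (p : M) :
  exists c x, [/\ atlas c, chart_cod c x & chart_inv c x = p].
Proof.
have [_ cover _] := @atlas_smooth R n M; have [c Ac cp] := cover p.
exists c, (chart_map c p); split=> //; first by exists p.
by have [_ _ invK _ _] := atlas_chart Ac; exact: invK.
Qed.

End SmoothFunctions.

Section VectorFields.
Variables (R : realType) (n : nat) (M : manifoldType R n).
Implicit Types (f h : M -> R) (c : chart R n M) (X Y : operator M R).

(** At a single point, the components of the local expression are mere numbers
    [b i], which is enough for all identities that are proved pointwise. *)
Lemma vector_field_at X p : vector_field X ->
  exists c x (b : 'I_n -> R), [/\ atlas c, chart_cod c x, chart_inv c x = p &
    forall f, smooth_fun f ->
      X f p = \sum_(i < n) b i * 'D_(delta_mx 0 i) (f \o chart_inv c) x].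
Proof.
move=> [_ locX]; have [c [x [Ac cx <-]]] := in_chart p.
have [a _ Xa] := locX c Ac.
by exists c, x, (fun i => a x 0 i); split=> // f sf; exact: Xa.
Qed.

Lemma vf_nonsmooth X f : vector_field X -> ~ smooth_fun f -> X f = 0.
Proof. by move=> [X0 _] /X0 ->. Qed.

(** In a chart, [X f] is a sum of products of components of [X] and partial
    derivatives of [f]; without this, neither [Y (X f)] nor the bracket would
    be controlled by the local expressions. *)
Lemma vf_smooth X f : vector_field X -> smooth_fun f -> smooth_fun (X f).
Proof.
move=> [_ locX] sf c Ac k; have oc := open_chart_cod Ac.
have [a sa Xa] := locX c Ac.
apply: (Ck_on_ext oc) (_ : Ck_on k _ (fun x =>
    \sum_(i < n) a x 0 i *: 'D_(delta_mx 0 i) (f \o chart_inv c) x)).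
  by move=> x /set_mem cx /=; rewrite Xa.
apply: Ck_on_sum => // i; apply: Ck_onZ => //; last first.
  by have [_ /(_ (delta_mx 0 i))[]] := sf c Ac k.+1.
pose coord (u : 'rV[R]_n) := u 0 i.
have coord_lin : linear coord by move=> t u v; rewrite /coord !mxE.
pose L := GRing.isLinear.Build R 'rV[R]_n R _ coord coord_lin.
pose coordL : {linear 'rV[R]_n -> R} := HB.pack coord L.
exact (Ck_on_lin oc (L := coordL) (@coord_continuous _ _ _ 0 i) (sa k)).
Qed.

Lemma vf_cst X r : vector_field X -> X (cst r) = 0.
Proof.
move=> vX; apply/funext => p.
have [c [x [b [Ac cx _ ->]]]] := vector_field_at p vX; last exact: smooth_cst.
by rewrite big1 // => i _; rewrite derive_cst mulr0.
Qed.

Lemma vf_actD X f h : vector_field X -> smooth_fun f -> smooth_fun h ->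
  X (f + h) = X f + X h.
Proof.
move=> vX sf sh; apply/funext => p.
have [c [x [b [Ac cx _ Xb]]]] := vector_field_at p vX.
rewrite [in RHS]addrfctE !Xb //; last exact: smoothD.
rewrite -big_split; apply: eq_bigr => i _ /=; rewrite -mulrDr -deriveD //;
  exact: smooth_derivable.
Qed.

Lemma vf_actM X f h : vector_field X -> smooth_fun f -> smooth_fun h ->
  X (f * h) = f * X h + X f * h.
Proof.
move=> vX sf sh; apply/funext => p.
have [c [x [b [Ac cx xp Xb]]]] := vector_field_at p vX.
rewrite [in RHS]addrfctE ![in RHS]mulrfctE !Xb //; last exact: smoothM.
rewrite mulr_sumr mulr_suml -big_split; apply: eq_bigr => i _ /=.
have := deriveM (smooth_derivable (v := delta_mx 0 i) sf Ac cx)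
  (smooth_derivable (v := delta_mx 0 i) sh Ac cx).
rewrite /= xp => e; rewrite [X in b i * X]e /GRing.scale /=; ring.
Qed.

Lemma vector_fieldD X Y : vector_field X -> vector_field Y ->
  vector_field (X + Y).
Proof.
move=> [X0 locX] [Y0 locY]; split=> [f nsf|c Ac].
  by rewrite addrfctE X0 // Y0 // addr0.
have [a sa Xa] := locX c Ac; have [b sb Yb] := locY c Ac.
exists (fun x => a x + b x).
  by move=> k; exact (Ck_onD (open_chart_cod Ac) (sa k) (sb k)).
move=> f sf x cx; rewrite !addrfctE Xa // Yb // -big_split.
by apply: eq_bigr => i _; rewrite mxE mulrDl.
Qed.

Lemma vector_fieldZ h X : smooth_fun h -> vector_field X ->
  vector_field (fscale h X).
Proof.
move=> sh [X0 locX]; split=> [f nsf|c Ac].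
  by apply/funext => p; rewrite /fscale X0 // mulr0.
have [a sa Xa] := locX c Ac.
exists (fun x => h (chart_inv c x) *: a x).
  by move=> k; exact (Ck_onZ (open_chart_cod Ac) (sh c Ac k) (sa k)).
move=> f sf x cx; rewrite /fscale Xa // mulr_sumr.
by apply: eq_bigr => i _; rewrite mxE mulrA.
Qed.

(** Real scalars are constant functions, so that linearity over the reals is a
    case of linearity over smooth functions. *)
Lemma scale_fscale (r : R) X : r *: X = fscale (cst r) X.
Proof. by []. Qed.

Lemma vector_fieldZr (r : R) X : vector_field X -> vector_field (r *: X).
Proof. by rewrite scale_fscale; apply: vector_fieldZ; exact: smooth_cst. Qed.

Lemma vector_fieldN X : vector_field X -> vector_field (- X).
Proof. by rewrite -scaleN1r; exact: vector_fieldZr. Qed.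

Lemma vector_fieldB X Y : vector_field X -> vector_field Y ->
  vector_field (X - Y).
Proof. by move=> vX vY; apply: vector_fieldD => //; exact: vector_fieldN. Qed.

End VectorFields.

(** * Connections and tensoriality of the curvature *)

(** Closure of smooth functions and of vector fields under the operations. *)
Create HintDb geom.
#[export] Hint Resolve smooth_cst smoothD smoothM smoothN vf_smooth
  vector_fieldD vector_fieldZ vector_fieldZr vector_fieldN vector_fieldB : geom.
Ltac geom := by auto 20 with geom.
(** Identities in the module of operators become ring identities once they are
    evaluated at a function and at a point. *)
Ltac pointwise :=
  rewrite ?scale_fscale; apply/funext => ?; apply/funext => ?;
  rewrite /fscale !(addrfctE, opprfctE, mulrfctE); ring.

Lemma fscale0 (R : realType) (M : Type) (X : operator M R) : fscale 0 X = 0.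
Proof. by apply/funext => f; apply/funext => p; exact: mul0r. Qed.

Section Connections.
Variables (R : realType) (n : nat) (M : manifoldType R n).
Implicit Types (f h : M -> R) (X Y Z : operator M R).
Variable nabla : operator M R -> operator M R -> operator M R.
Hypothesis nablaP : linear_connection nabla.

Lemma conn_vf X Y : vector_field X -> vector_field Y ->
  vector_field (nabla X Y).
Proof. by move=> vX vY; have [] := nablaP vX vX vY vY. Qed.

Lemma connDl X X' Y : vector_field X -> vector_field X' -> vector_field Y ->
  nabla (X + X') Y = nabla X Y + nabla X' Y.
Proof. by move=> vX vX' vY; have [] := nablaP vX vX' vY vY. Qed.

Lemma connDr X Y Y' : vector_field X -> vector_field Y -> vector_field Y' ->
  nabla X (Y + Y') = nabla X Y + nabla X Y'.
Proof. by move=> vX vY vY'; have [] := nablaP vX vX vY vY'. Qed.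

Lemma connZl h X Y : smooth_fun h -> vector_field X -> vector_field Y ->
  nabla (fscale h X) Y = fscale h (nabla X Y).
Proof.
by move=> sh vX vY; have [_ _ _ /(_ h sh)[]] := nablaP vX vX vY vY.
Qed.

Lemma connZr h X Y : smooth_fun h -> vector_field X -> vector_field Y ->
  nabla X (fscale h Y) = fscale (X h) Y + fscale h (nabla X Y).
Proof.
by move=> sh vX vY; have [_ _ _ /(_ h sh)[]] := nablaP vX vX vY vY.
Qed.

Lemma conn_scalel (r : R) X Y : vector_field X -> vector_field Y ->
  nabla (r *: X) Y = r *: nabla X Y.
Proof. by move=> vX vY; rewrite !scale_fscale connZl //; geom. Qed.

Lemma conn_scaler (r : R) X Y : vector_field X -> vector_field Y ->
  nabla X (r *: Y) = r *: nabla X Y.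
Proof.
move=> vX vY; rewrite !scale_fscale connZr //; last geom.
by rewrite (vf_cst r vX) fscale0 add0r.
Qed.

Lemma connNl X Y : vector_field X -> vector_field Y ->
  nabla (- X) Y = - nabla X Y.
Proof. by move=> vX vY; rewrite -scaleN1r conn_scalel // scaleN1r. Qed.

Hint Resolve conn_vf : geom.

Hypothesis bracket_vf : forall X Y,
  vector_field X -> vector_field Y -> vector_field (bracket X Y).
Hint Resolve bracket_vf : geom.

(** Operators are equal only if they agree on all functions; on the ones that
    are not smooth, every vector field vanishes by convention. *)
Lemma bracketDl X X' Y : vector_field X -> vector_field X' -> vector_field Y ->
  bracket (X + X') Y = bracket X Y + bracket X' Y.
Proof.
move=> vX vX' vY; apply/funext => f.
have [sf|nsf] := pselect (smooth_fun f); last first.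
  by rewrite !(vf_nonsmooth _ nsf); geom.
rewrite /bracket [in LHS]addrfctE [in RHS]addrfctE (vf_actD vY); try geom.
by rewrite opprD addrACA.
Qed.

Lemma bracketZl h X Y : smooth_fun h -> vector_field X -> vector_field Y ->
  bracket (fscale h X) Y = fscale h (bracket X Y) - fscale (Y h) X.
Proof.
move=> sh vX vY; apply/funext => f.
have [sf|nsf] := pselect (smooth_fun f); last first.
  by rewrite !(vf_nonsmooth _ nsf); geom.
rewrite /bracket [fscale h X f](_ : _ = h * X f) // (vf_actM vY); try geom.
by apply/funext => p; rewrite /fscale !(addrfctE, opprfctE, mulrfctE); ring.
Qed.

Lemma curv_vf X Y Z : vector_field X -> vector_field Y -> vector_field Z ->
  vector_field (curvature nabla X Y Z).
Proof. by move=> vX vY vZ; rewrite /curvature; geom. Qed.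

Lemma curvDl X X' Y Z : vector_field X -> vector_field X' ->
  vector_field Y -> vector_field Z ->
  curvature nabla (X + X') Y Z = curvature nabla X Y Z + curvature nabla X' Y Z.
Proof.
move=> vX vX' vY vZ; rewrite /curvature bracketDl //.
have vb := bracket_vf vX vY; have vb' := bracket_vf vX' vY.
rewrite !(connDl vX vX') ?(connDl vb vb') ?(connDr vY (conn_vf vX vZ));
  try geom.
pointwise.
Qed.

(** The derivative of [h] produced by [nabla Y (nabla (h X) Z)] cancels the one
    in [[h X, Y] = h [X, Y] - Y(h) X]. *)
Lemma curvZl h X Y Z : smooth_fun h -> vector_field X ->
  vector_field Y -> vector_field Z ->
  curvature nabla (fscale h X) Y Z = fscale h (curvature nabla X Y Z).
Proof.
move=> sh vX vY vZ; rewrite /curvature bracketZl //.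
have vhb : vector_field (fscale h (bracket X Y)) by geom.
have vYhX : vector_field (fscale (Y h) X) by geom.
rewrite (connDl vhb (vector_fieldN vYhX)) // connNl // !connZl; try geom.
rewrite connZr; try geom.
pointwise.
Qed.

Lemma curvDr X Y Z Z' : vector_field X -> vector_field Y ->
  vector_field Z -> vector_field Z' ->
  curvature nabla X Y (Z + Z') = curvature nabla X Y Z + curvature nabla X Y Z'.
Proof.
move=> vX vY vZ vZ'; rewrite /curvature.
rewrite !(@connDr _ Z Z'); try geom.
rewrite (@connDr X (nabla Y Z)) ?(@connDr Y (nabla X Z)); try geom.
pointwise.
Qed.

(** The second derivatives of [h] amount to [X (Y h) - Y (X h) - [X, Y] h],
    which vanishes by the definition of the bracket. *)
Lemma curvZr h X Y Z : smooth_fun h -> vector_field X ->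
  vector_field Y -> vector_field Z ->
  curvature nabla X Y (fscale h Z) = fscale h (curvature nabla X Y Z).
Proof.
move=> sh vX vY vZ; rewrite /curvature.
rewrite !(@connZr h _ Z) //; try geom.
rewrite (@connDr X (fscale (Y h) Z)) ?(@connDr Y (fscale (X h) Z)); try geom.
rewrite !connZr; try geom.
rewrite [bracket X Y h]/bracket; pointwise.
Qed.

End Connections.
#[export] Hint Resolve conn_vf curv_vf : geom.

(** * Symmetric tensors and their covariant derivative *)

(** Shared by a metric, of which it keeps everything but the signature, and by
    the symmetrized Ricci tensor. *)
Definition symmetric_tensor (R : realType) (n : nat) (M : manifoldType R n)
    (omega : operator M R -> operator M R -> M -> R) :=
  forall X X' Y : operator M R, vector_field X -> vector_field X' ->
    vector_field Y ->
  [/\ smooth_fun (omega X Y), omega X Y = omega Y X,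
      omega (X + X') Y = omega X Y + omega X' Y &
      forall h : M -> R, smooth_fun h -> omega (fscale h X) Y = h * omega X Y].

Section SymmetricTensors.
Variables (R : realType) (n : nat) (M : manifoldType R n).
Implicit Types (f h : M -> R) (X Y Z : operator M R).
Variable omega : operator M R -> operator M R -> M -> R.
Hypothesis omegaP : symmetric_tensor omega.

Lemma tensor_smooth X Y : vector_field X -> vector_field Y ->
  smooth_fun (omega X Y).
Proof. by move=> vX vY; have [] := omegaP vX vX vY. Qed.

Lemma tensorC X Y : vector_field X -> vector_field Y ->
  omega X Y = omega Y X.
Proof. by move=> vX vY; have [] := omegaP vX vX vY. Qed.

Lemma tensorDl X X' Y : vector_field X -> vector_field X' -> vector_field Y ->
  omega (X + X') Y = omega X Y + omega X' Y.
Proof. by move=> vX vX' vY; have [] := omegaP vX vX' vY. Qed.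

Lemma tensorZl h X Y : smooth_fun h -> vector_field X -> vector_field Y ->
  omega (fscale h X) Y = h * omega X Y.
Proof. by move=> sh vX vY; have [_ _ _] := omegaP vX vX vY; apply. Qed.

Hint Resolve tensor_smooth : geom.

Lemma tensorDr X Y Y' : vector_field X -> vector_field Y -> vector_field Y' ->
  omega X (Y + Y') = omega X Y + omega X Y'.
Proof.
move=> vX vY vY'; rewrite tensorC; try geom.
by rewrite tensorDl // !(@tensorC X).
Qed.

Lemma tensorZr h X Y : smooth_fun h -> vector_field X -> vector_field Y ->
  omega X (fscale h Y) = h * omega X Y.
Proof.
move=> sh vX vY; rewrite tensorC; try geom.
by rewrite tensorZl // tensorC.
Qed.

Variable nabla : operator M R -> operator M R -> operator M R.
Hypothesis nablaP : linear_connection nabla.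
Local Notation "'cov'" := (cov_deriv nabla omega).
Hint Resolve conn_vf : geom.

(** By symmetry, linearity in the third argument reduces to linearity in the
    second one. *)
Lemma cov_derivC X Y Z : vector_field X -> vector_field Y -> vector_field Z ->
  cov X Y Z = cov X Z Y.
Proof.
move=> vX vY vZ; rewrite /cov_deriv (tensorC vY vZ).
rewrite (tensorC (conn_vf nablaP vX vY) vZ) (tensorC vY (conn_vf nablaP vX vZ)).
by rewrite addrAC.
Qed.

Lemma cov_derivDl X X' Y Z : vector_field X -> vector_field X' ->
  vector_field Y -> vector_field Z ->
  cov (X + X') Y Z = cov X Y Z + cov X' Y Z.
Proof.
move=> vX vX' vY vZ; rewrite /cov_deriv !connDl // tensorDl ?tensorDr; try geom.
by apply/funext => p; rewrite !(addrfctE, opprfctE, mulrfctE); ring.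
Qed.

Lemma cov_derivZl h X Y Z : smooth_fun h -> vector_field X ->
  vector_field Y -> vector_field Z ->
  cov (fscale h X) Y Z = h * cov X Y Z.
Proof.
move=> sh vX vY vZ; rewrite /cov_deriv !connZl // tensorZl ?tensorZr; try geom.
by apply/funext => p; rewrite /fscale !(addrfctE, opprfctE, mulrfctE); ring.
Qed.

Lemma cov_derivDm X Y Y' Z : vector_field X -> vector_field Y ->
  vector_field Y' -> vector_field Z ->
  cov X (Y + Y') Z = cov X Y Z + cov X Y' Z.
Proof.
move=> vX vY vY' vZ; rewrite /cov_deriv connDr // !tensorDl ?(vf_actD vX);
  try geom.
by apply/funext => p; rewrite !(addrfctE, opprfctE, mulrfctE); ring.
Qed.

Lemma cov_derivZm h X Y Z : smooth_fun h -> vector_field X ->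
  vector_field Y -> vector_field Z ->
  cov X (fscale h Y) Z = h * cov X Y Z.
Proof.
move=> sh vX vY vZ; rewrite /cov_deriv connZr // tensorDl; try geom.
rewrite !tensorZl ?(vf_actM vX); try geom.
by apply/funext => p; rewrite !(addrfctE, opprfctE, mulrfctE); ring.
Qed.

Lemma cov_derivDr X Y Z Z' : vector_field X -> vector_field Y ->
  vector_field Z -> vector_field Z' ->
  cov X Y (Z + Z') = cov X Y Z + cov X Y Z'.
Proof.
move=> vX vY vZ vZ'; rewrite cov_derivC; try geom.
by rewrite cov_derivDm // !(@cov_derivC X Y).
Qed.

Lemma cov_derivZr h X Y Z : smooth_fun h -> vector_field X ->
  vector_field Y -> vector_field Z ->
  cov X Y (fscale h Z) = h * cov X Y Z.
Proof.
move=> sh vX vY vZ; rewrite cov_derivC; try geom.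
by rewrite cov_derivZm // cov_derivC.
Qed.

End SymmetricTensors.

(** * The Ricci tensor *)

Section RicciTensor.
Variables (R : realType) (n : nat) (M : manifoldType R n).
Implicit Types (f h : M -> R) (X Y Z : operator M R).
Variables (g : operator M R -> operator M R -> M -> R)
  (nabla : operator M R -> operator M R -> operator M R)
  (e1 e2 e3 : operator M R).
Hypotheses (gP : symmetric_tensor g) (nablaP : linear_connection nabla)
  (bracket_vf : forall X Y,
     vector_field X -> vector_field Y -> vector_field (bracket X Y))
  (ve1 : vector_field e1) (ve2 : vector_field e2) (ve3 : vector_field e3).
Local Notation Ric := (ricci g nabla e1 e2 e3).
Hint Resolve conn_vf tensor_smooth curv_vf : geom.

Lemma ricci_smooth X Y : vector_field X -> vector_field Y ->
  smooth_fun (Ric X Y).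
Proof. by move=> vX vY; rewrite /ricci; geom. Qed.

Lemma ricciDl X X' Y : vector_field X -> vector_field X' -> vector_field Y ->
  Ric (X + X') Y = Ric X Y + Ric X' Y.
Proof.
move=> vX vX' vY; rewrite /ricci !curvDl // !(tensorDl gP); try geom.
by apply/funext => p; rewrite !(addrfctE, opprfctE, mulrfctE); ring.
Qed.

Lemma ricciDr X Y Y' : vector_field X -> vector_field Y -> vector_field Y' ->
  Ric X (Y + Y') = Ric X Y + Ric X Y'.
Proof.
move=> vX vY vY'; rewrite /ricci !curvDr // !(tensorDl gP); try geom.
by apply/funext => p; rewrite !(addrfctE, opprfctE, mulrfctE); ring.
Qed.

Lemma ricciZl h X Y : smooth_fun h -> vector_field X -> vector_field Y ->
  Ric (fscale h X) Y = h * Ric X Y.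
Proof.
move=> sh vX vY; rewrite /ricci !curvZl // !(tensorZl gP); try geom.
by apply/funext => p; rewrite !(addrfctE, opprfctE, mulrfctE); ring.
Qed.

Lemma ricciZr h X Y : smooth_fun h -> vector_field X -> vector_field Y ->
  Ric X (fscale h Y) = h * Ric X Y.
Proof.
move=> sh vX vY; rewrite /ricci !curvZr // !(tensorZl gP); try geom.
by apply/funext => p; rewrite !(addrfctE, opprfctE, mulrfctE); ring.
Qed.

Lemma sym_ricci_tensor : symmetric_tensor (sym_ricci g nabla e1 e2 e3).
Proof.
(* halving is the product with a constant function, a smooth one *)
have symE X Y : sym_ricci g nabla e1 e2 e3 X Y =
    (Ric X Y + Ric Y X) * cst (2^-1) by [].
move=> X X' Y vX vX' vY; split=> [|||h sh]; rewrite !symE.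
- by have := ricci_smooth vX vY; have := ricci_smooth vY vX; geom.
- by rewrite addrC.
- rewrite ricciDl // ricciDr //.
  by apply/funext => p; rewrite !(addrfctE, mulrfctE); ring.
- rewrite ricciZl // ricciZr //.
  by apply/funext => p; rewrite !(addrfctE, mulrfctE); ring.
Qed.

End RicciTensor.

(** * Constant combinations of a frame *)

Section BottFrame.
Variables (R : realType) (M : manifoldType R 3) (e1 e2 e3 : operator M R).
Hypotheses (ve1 : vector_field e1) (ve2 : vector_field e2)
  (ve3 : vector_field e3).

Implicit Types (h : M -> R) (X Y Z : operator M R).

(** Constant combinations are closed under all the operations at hand, so that
    geometric computations become polynomial identities between triples. *)
Definition comb (a b c : R) : operator M R := a *: e1 + b *: e2 + c *: e3.

Lemma comb_vf a b c : vector_field (comb a b c).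
Proof. by rewrite /comb; geom. Qed.

Ltac combring := apply/funext => f; apply/funext => p;
  rewrite /comb !(addrfctE, opprfctE, scalrfctE) /GRing.scale /=; ring.

Lemma comb1E : e1 = comb 1 0 0. Proof. combring. Qed.
Lemma comb2E : e2 = comb 0 1 0. Proof. combring. Qed.
Lemma comb3E : e3 = comb 0 0 1. Proof. combring. Qed.

Lemma combB a b c a' b' c' :
  comb a b c - comb a' b' c' = comb (a - a') (b - b') (c - c').
Proof. combring. Qed.

Lemma conn_comb nabla : linear_connection nabla ->
  forall x1 x2 x3 y1 y2 y3,
  nabla (comb x1 x2 x3) (comb y1 y2 y3) =
    x1 *: (y1 *: nabla e1 e1 + y2 *: nabla e1 e2 + y3 *: nabla e1 e3)
  + x2 *: (y1 *: nabla e2 e1 + y2 *: nabla e2 e2 + y3 *: nabla e2 e3)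
  + x3 *: (y1 *: nabla e3 e1 + y2 *: nabla e3 e2 + y3 *: nabla e3 e3).
Proof.
move=> nP x1 x2 x3 y1 y2 y3.
have right X : vector_field X -> nabla X (comb y1 y2 y3) =
    y1 *: nabla X e1 + y2 *: nabla X e2 + y3 *: nabla X e3.
  move=> vX; rewrite /comb (connDr nP vX (Y := _ + _)) ?(connDr nP vX);
    try geom.
  by rewrite !(conn_scaler nP).
rewrite {1}/comb.
have vy := comb_vf y1 y2 y3.
rewrite (connDl nP (X := _ + _)) ?(connDl nP (X := _ *: _)); try geom.
by rewrite !(conn_scalel nP) // !right.
Qed.

(** Reduces a property that is linear over smooth functions to the frame. *)
Lemma frame_ind (P : operator M R -> Prop) :
  (forall X, vector_field X -> exists h1 h2 h3 : M -> R,
     [/\ smooth_fun h1, smooth_fun h2, smooth_fun h3 &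
         X = fscale h1 e1 + fscale h2 e2 + fscale h3 e3]) ->
  (forall X Y, vector_field X -> vector_field Y -> P X -> P Y -> P (X + Y)) ->
  (forall h X, smooth_fun h -> vector_field X -> P X -> P (fscale h X)) ->
  P e1 -> P e2 -> P e3 -> forall X, vector_field X -> P X.
Proof.
move=> span PD PZ P1 P2 P3 X /span[h1 [h2 [h3 [s1 s2 s3 ->]]]].
have v1 := vector_fieldZ s1 ve1; have v2 := vector_fieldZ s2 ve2.
have v12 := vector_fieldD v1 v2; have v3 := vector_fieldZ s3 ve3.
by apply: (PD _ _ v12 v3); [apply: (PD _ _ v1 v2)|]; apply: PZ.
Qed.

(** * Orthonormal frame and projections *)

Variable g : operator M R -> operator M R -> M -> R.
Hypotheses (gP : symmetric_tensor g)
  (eortho : forall p, orthonormal_at g e1 e2 e3 p).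

Lemma g11 : g e1 e1 = cst 1.
Proof. by apply/funext => p; have [[? ? ?] [? ? ?]] := eortho p. Qed.
Lemma g22 : g e2 e2 = cst 1.
Proof. by apply/funext => p; have [[? ? ?] [? ? ?]] := eortho p. Qed.
Lemma g33 : g e3 e3 = cst (-1).
Proof. by apply/funext => p; have [[? ? ?] [? ? ?]] := eortho p. Qed.
Lemma g12 : g e1 e2 = cst 0.
Proof. by apply/funext => p; have [[? ? ?] [? ? ?]] := eortho p. Qed.
Lemma g13 : g e1 e3 = cst 0.
Proof. by apply/funext => p; have [[? ? ?] [? ? ?]] := eortho p. Qed.
Lemma g23 : g e2 e3 = cst 0.
Proof. by apply/funext => p; have [[? ? ?] [? ? ?]] := eortho p. Qed.
Lemma g21 : g e2 e1 = cst 0. Proof. by rewrite (tensorC gP) ?g12. Qed.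
Lemma g31 : g e3 e1 = cst 0. Proof. by rewrite (tensorC gP) ?g13. Qed.
Lemma g32 : g e3 e2 = cst 0. Proof. by rewrite (tensorC gP) ?g23. Qed.
Definition gE := (g11, g22, g33, g12, g13, g23, g21, g31, g32).

Lemma g_fcomb h1 h2 h3 : smooth_fun h1 -> smooth_fun h2 -> smooth_fun h3 ->
  let X := fscale h1 e1 + fscale h2 e2 + fscale h3 e3 in
  [/\ g X e1 = h1, g X e2 = h2 & g X e3 = - h3].
Proof.
move=> s1 s2 s3 X; rewrite /X.
have gX e : vector_field e -> g (fscale h1 e1 + fscale h2 e2 + fscale h3 e3) e
    = h1 * g e1 e + h2 * g e2 e + h3 * g e3 e.
  move=> ve; rewrite (tensorDl gP (X := _ + _)); try geom.
  rewrite (tensorDl gP (X := fscale _ _)); try geom.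
  by rewrite !(tensorZl gP).
split; rewrite gX // !gE; apply/funext => p;
  rewrite !(addrfctE, opprfctE, mulrfctE, cstE); ring.
Qed.

Lemma g_comb a b c : [/\ g (comb a b c) e1 = cst a, g (comb a b c) e2 = cst b
  & g (comb a b c) e3 = cst (- c)].
Proof.
by have := g_fcomb (smooth_cst (M := M) a)
  (smooth_cst (M := M) b) (smooth_cst (M := M) c).
Qed.

Variables piD piD' : operator M R -> operator M R.
Hypothesis piP : projections (span2 e1 e2) (span1 e3) piD piD'.

(** The projections of [X] onto the two distributions supply global smooth
    coefficients at once. *)
Lemma frame_span X : vector_field X -> exists h1 h2 h3 : M -> R,
  [/\ smooth_fun h1, smooth_fun h2, smooth_fun h3 &
      X = fscale h1 e1 + fscale h2 e2 + fscale h3 e3].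
Proof.
move=> vX; have [_ /(_ X vX)[]] := piP.
move=> [h1 [h2 [s1 s2 ->]]] [h3 s3 ->] ->.
by exists h1, h2, h3.
Qed.

(** The coefficients of a projection are recovered by pairing with the frame;
    the sign on [e3] is the timelike one. *)
Lemma piE X : vector_field X ->
  piD X = fscale (g X e1) e1 + fscale (g X e2) e2 /\
  piD' X = fscale (- g X e3) e3.
Proof.
move=> vX; have [_ /(_ X vX)[]] := piP.
move=> [h1 [h2 [s1 s2 ->]]] [h3 s3 ->] XE.
have [] := g_fcomb s1 s2 s3; rewrite -XE => -> -> ->.
by rewrite opprK.
Qed.

Lemma piD_of_metric X a b :
  vector_field X -> g X e1 = cst a -> g X e2 = cst b ->
  piD X = comb a b 0.
Proof.
by move=> vX ga gb; rewrite (piE vX).1 ga gb -!scale_fscale /comb scale0r addr0.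
Qed.

Lemma piD'_of_metric X c : vector_field X -> g X e3 = cst (- c) ->
  piD' X = comb 0 0 c.
Proof.
move=> vX gc; rewrite (piE vX).2 gc /comb !scale0r !add0r.
by rewrite [- cst _](_ : _ = cst c) //; apply/funext => p; exact: opprK.
Qed.

Lemma span2_1 : span2 e1 e2 e1.
Proof.
exists (cst 1), (cst 0); split; try exact: smooth_cst.
by rewrite -!scale_fscale scale1r scale0r addr0.
Qed.
Lemma span2_2 : span2 e1 e2 e2.
Proof.
exists (cst 0), (cst 1); split; try exact: smooth_cst.
by rewrite -!scale_fscale scale1r scale0r add0r.
Qed.
Lemma span1_3 : span1 e3 e3.
Proof.
by exists (cst 1); [exact: smooth_cst|rewrite -scale_fscale scale1r].
Qed.

(** * The Levi-Civita connection on the frame *)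

Variables nablaL nablaB : operator M R -> operator M R -> operator M R.
Hypothesis hL : levi_civita g nablaL.

(** Vanishing torsion expresses the bracket by covariant derivatives, which
    are vector fields. *)
Lemma bracket_vf X Y : vector_field X -> vector_field Y ->
  vector_field (bracket X Y).
Proof.
move=> vX vY; have [LP torsion _] := hL.
rewrite -torsion //.
by have := conn_vf LP vX vY; have := conn_vf LP vY vX; geom.
Qed.

Lemma bracket_comb x1 x2 x3 y1 y2 y3 :
  bracket (comb x1 x2 x3) (comb y1 y2 y3) =
    (x1 * y2 - x2 * y1) *: bracket e1 e2
  + (x1 * y3 - x3 * y1) *: bracket e1 e3
  + (x2 * y3 - x3 * y2) *: bracket e2 e3.
Proof.
have [LP torsion _] := hL; rewrite -!torsion //; try exact: comb_vf.
rewrite !(conn_comb LP); combring.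
Qed.

(** Where the metric is constant, [nablaL X] is skew-symmetric for it. *)
Lemma lc_skew X Y Z r : vector_field X -> vector_field Y -> vector_field Z ->
  g Y Z = cst r -> g (nablaL X Y) Z = - g (nablaL X Z) Y.
Proof.
move=> vX vY vZ gYZ; have [LP _ compat] := hL.
have := compat X Y Z vX vY vZ; rewrite gYZ vf_cst // => /esym/eqP.
by rewrite addr_eq0 => /eqP ->; rewrite (tensorC gP) //; exact: conn_vf.
Qed.

Lemma lc_skew0 X Y r : vector_field X -> vector_field Y ->
  g Y Y = cst r -> g (nablaL X Y) Y = cst 0.
Proof.
move=> vX vY gYY; have e := lc_skew vX vY vY gYY; apply/funext => p.
have := congr1 (fun F => F p) e; rewrite opprfctE /= /cst; lra.
Qed.

Variables (alpha beta gamma : R).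
Hypotheses (e12 : bracket e1 e2 = comb 0 (-1) gamma)
  (e13 : bracket e1 e3 = comb 0 (- beta) 1)
  (e23 : bracket e2 e3 = comb alpha 0 0).

(** With [lc_skew], this is the Koszul argument: skew-symmetry leaves, among the
    components of [nablaL] tangent to the plane of [e1] and [e2], the two below,
    and the exchange of [e1] and [e2] determines both of them. *)
Lemma lc_swap X Y Z a : vector_field X -> vector_field Y -> vector_field Z ->
  g (bracket X Y) Z = cst a ->
  g (nablaL X Y) Z = g (nablaL Y X) Z + cst a.
Proof.
move=> vX vY vZ <-; have [LP torsion _] := hL.
have vYX := conn_vf LP vY vX.
rewrite -(tensorDl gP vYX (bracket_vf vX vY) vZ) -torsion //.
by rewrite addrC subrK.
Qed.

Lemma lc121 : g (nablaL e1 e2) e1 = cst 0.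
Proof.
have [gb _ _] := g_comb 0 (-1) gamma; rewrite -e12 in gb.
by rewrite (lc_swap ve1 ve2 ve1 gb) (lc_skew0 ve2 ve1 g11) addr0.
Qed.

Lemma lc212 : g (nablaL e2 e1) e2 = cst 1.
Proof.
have [_ gb _] := g_comb 0 (-1) gamma; rewrite -e12 in gb.
have := lc_swap ve1 ve2 ve2 gb; rewrite (lc_skew0 ve1 ve2 g22) => /esym/eqP.
by rewrite addr_eq0 => /eqP ->; apply/funext => p; exact: opprK.
Qed.

(** * The Bott connection, its curvature and its Ricci tensor *)

Hypothesis hB : bott_connection (span2 e1 e2) (span1 e3) piD piD' nablaL nablaB.

Lemma bracketC X Y : bracket X Y = - bracket Y X.
Proof. by rewrite /bracket; apply/funext => f; rewrite opprfctE opprB. Qed.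

Lemma combN a b c : - comb a b c = comb (- a) (- b) (- c).
Proof. combring. Qed.

Lemma piD_comb a b c : piD (comb a b c) = comb a b 0.
Proof.
by have [] := g_comb a b c => *; apply: piD_of_metric => //; exact: comb_vf.
Qed.
Lemma piD'_comb a b c : piD' (comb a b c) = comb 0 0 c.
Proof.
by have [] := g_comb a b c => *; apply: piD'_of_metric => //; exact: comb_vf.
Qed.

Lemma bott_frame :
  [/\ nablaB e1 e1 = comb 0 0 0, nablaB e1 e2 = comb 0 0 0
    & nablaB e1 e3 = comb 0 0 1] /\
  [/\ nablaB e2 e1 = comb 0 1 0, nablaB e2 e2 = comb (-1) 0 0
    & nablaB e2 e3 = comb 0 0 0] /\
  [/\ nablaB e3 e1 = comb 0 beta 0, nablaB e3 e2 = comb (- alpha) 0 0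
    & nablaB e3 e3 = comb 0 0 0].
Proof.
have [LP _ _] := hL; have [_ DD D'D DD' D'D'] := hB.
have vf X Y : vector_field X -> vector_field Y -> vector_field (nablaL X Y).
  exact: conn_vf.
have s1 := span2_1; have s2 := span2_2; have s3 := span1_3.
have N0 : (- cst 0 : M -> R) = cst 0 by exact: oppr0.
split; [split|split; split].
- rewrite DD //; apply: piD_of_metric; [exact: vf|exact: lc_skew0 g11|].
  by rewrite (lc_skew ve1 ve1 ve2 g12) lc121 N0.
- by rewrite DD //; apply: piD_of_metric;
    [exact: vf|exact: lc121|exact: lc_skew0 g22].
- by rewrite DD' // e13 piD'_comb.
- by rewrite DD //; apply: piD_of_metric;
    [exact: vf|exact: lc_skew0 g11|exact: lc212].
- rewrite DD //; apply: piD_of_metric; [exact: vf| |exact: lc_skew0 g22].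
  by rewrite (lc_skew ve2 ve2 ve1 g21) lc212.
- by rewrite DD' // e23 piD'_comb.
- by rewrite D'D // bracketC e13 combN piD_comb oppr0 opprK.
- by rewrite D'D // bracketC e23 combN piD_comb oppr0.
- rewrite D'D' //; apply: piD'_of_metric; first exact: vf.
  by rewrite oppr0; exact: lc_skew0 g33.
Qed.

Lemma bott_comb x1 x2 x3 y1 y2 y3 :
  nablaB (comb x1 x2 x3) (comb y1 y2 y3) =
  comb (- (x2 + alpha * x3) * y2) ((x2 + beta * x3) * y1) (x1 * y3).
Proof.
have [BP _ _ _ _] := hB; rewrite (conn_comb BP).
have [[-> -> ->] [[-> -> ->] [-> -> ->]]] := bott_frame; combring.
Qed.

(** [p], [q], [r] are the components of the bivector of the first two
    arguments; the terms in [r * z1] and [r * z2] come from the commutator of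
    [nablaB e2] and [nablaB e3], the other ones from the bracket. *)
Lemma curvature_comb x1 x2 x3 y1 y2 y3 z1 z2 z3 :
  let p := x1 * y2 - x2 * y1 in let r := x2 * y3 - x3 * y2 in
  let q := x1 * y3 - x3 * y1 in
  curvature nablaB (comb x1 x2 x3) (comb y1 y2 y3) (comb z1 z2 z3) =
  comb ((alpha - beta) * r * z1
      + ((alpha * gamma - 1) * p + (alpha - beta) * q) * z2)
    ((beta - alpha) * r * z2 - (beta * gamma - 1) * p * z1)
    (- alpha * r * z3).
Proof.
rewrite /= /curvature bracket_comb e12 e13 e23.
rewrite (_ : _ *: _ + _ *: _ + _ *: _ =
  comb (alpha * (x2 * y3 - x3 * y2))
    (- (x1 * y2 - x2 * y1) - beta * (x1 * y3 - x3 * y1))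
    (gamma * (x1 * y2 - x2 * y1) + (x1 * y3 - x3 * y1))); last by combring.
rewrite !bott_comb !combB; congr comb; ring.
Qed.

Lemma ricci_comb x1 x2 x3 y1 y2 y3 :
  ricci g nablaB e1 e2 e3 (comb x1 x2 x3) (comb y1 y2 y3) =
  cst ((beta * gamma - 1) * (x1 * y1) + (alpha * gamma - 1) * (x2 * y2)
       + alpha * (x2 * y3)).
Proof.
have C1 := curvature_comb x1 x2 x3 1 0 0 y1 y2 y3.
have C2 := curvature_comb x1 x2 x3 0 1 0 y1 y2 y3.
have C3 := curvature_comb x1 x2 x3 0 0 1 y1 y2 y3.
move: C1 C2 C3; rewrite -comb1E -comb2E -comb3E /ricci => /= -> -> ->.
rewrite (let: And3 e _ _ := g_comb _ _ _ in e).
rewrite (let: And3 _ e _ := g_comb _ _ _ in e).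
rewrite (let: And3 _ _ e := g_comb _ _ _ in e).
by apply/funext => p; rewrite !(addrfctE, opprfctE, cstE); ring.
Qed.

(** * The Codazzi equation *)

Let omega := sym_ricci g nablaB e1 e2 e3.

Lemma sym_ricci_comb x1 x2 x3 y1 y2 y3 :
  omega (comb x1 x2 x3) (comb y1 y2 y3) =
  cst ((beta * gamma - 1) * (x1 * y1) + (alpha * gamma - 1) * (x2 * y2)
       + alpha / 2 * (x2 * y3 + x3 * y2)).
Proof.
rewrite /omega /sym_ricci !ricci_comb.
by apply/funext => p; rewrite /cst; field.
Qed.

Lemma cov_comb x1 x2 x3 y1 y2 y3 z1 z2 z3 :
  let a := x2 + alpha * x3 in let b := x2 + beta * x3 in
  cov_deriv nablaB omega (comb x1 x2 x3) (comb y1 y2 y3) (comb z1 z2 z3) =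
  cst ((((beta * gamma - 1) * a - (alpha * gamma - 1) * b) * (y1 * z2 + y2 * z1)
       - alpha / 2 * (x1 * (y2 * z3 + y3 * z2) + b * (y1 * z3 + y3 * z1)))).
Proof.
rewrite /cov_deriv !bott_comb !sym_ricci_comb (vf_cst _ (comb_vf _ _ _)).
by apply/funext => p; rewrite sub0r !(addrfctE, opprfctE, cstE) /=; field.
Qed.

(** The point [p0] is there to extract equations between real numbers from
    equations between functions. *)
Lemma codazzi_iff (p0 : M) : codazzi nablaB omega <-> (alpha = 0 /\ beta = 0).
Proof.
have [BP _ _ _ _] := hB.
split=> [cod|[a0 b0]].
  have c132 := congr1 (fun F => F p0)
    (cod _ _ _ (comb_vf 1 0 0) (comb_vf 0 0 1) (comb_vf 0 1 0)).
  have c133 := congr1 (fun F => F p0)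
    (cod _ _ _ (comb_vf 1 0 0) (comb_vf 0 0 1) (comb_vf 0 0 1)).
  move: c132 c133; rewrite !cov_comb !(addrfctE, opprfctE, cstE).
  rewrite (_ : (0 : M -> R) p0 = 0) // => c132 c133.
  have ab : alpha = 2 * beta by lra.
  have : beta ^+ 2 = 0 by rewrite ab in c133; lra.
  by move=> /eqP; rewrite sqrf_eq0 => /eqP b0; rewrite ab b0 mulr0.
have omegaP : symmetric_tensor omega.
  by apply: sym_ricci_tensor => //; exact: bracket_vf.
(* not only the Codazzi defect, but the covariant derivative itself vanishes *)
suff cov0 X Y Z : vector_field X -> vector_field Y -> vector_field Z ->
    cov_deriv nablaB omega X Y Z = 0.
  by move=> X Y Z vX vY vZ; rewrite !cov0 // subrr.
have cov0comb x1 x2 x3 y1 y2 y3 z1 z2 z3 : cov_deriv nablaB omega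
    (comb x1 x2 x3) (comb y1 y2 y3) (comb z1 z2 z3) = 0.
  rewrite cov_comb a0 b0; apply/funext => p.
  by rewrite (_ : (0 : M -> R) p = 0) // cstE; ring.
have cov0r x1 x2 x3 y1 y2 y3 Z0 : vector_field Z0 -> cov_deriv nablaB omega
    (comb x1 x2 x3) (comb y1 y2 y3) Z0 = 0.
  have vx := comb_vf x1 x2 x3; have vy := comb_vf y1 y2 y3; move: Z0.
  apply: (frame_ind frame_span) => [Z1 Z2 v1 v2 c1 c2|h Z1 sh v1 c1|||].
  - by rewrite (cov_derivDr omegaP BP) // c1 c2 addr0.
  - by rewrite (cov_derivZr omegaP BP) // c1 mulr0.
  - by rewrite comb1E.
  - by rewrite comb2E.
  - by rewrite comb3E.
have cov0m x1 x2 x3 Y0 Z0 : vector_field Y0 -> vector_field Z0 ->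
    cov_deriv nablaB omega (comb x1 x2 x3) Y0 Z0 = 0.
  move=> vY0 vZ0; have vx := comb_vf x1 x2 x3; move: Y0 vY0.
  apply: (frame_ind frame_span) => [Y1 Y2 v1 v2 c1 c2|h Y1 sh v1 c1|||].
  - by rewrite (cov_derivDm omegaP BP) // c1 c2 addr0.
  - by rewrite (cov_derivZm omegaP BP) // c1 mulr0.
  - by rewrite comb1E cov0r.
  - by rewrite comb2E cov0r.
  - by rewrite comb3E cov0r.
move=> vX vY vZ; move: X vX.
apply: (frame_ind frame_span) => [X1 X2 v1 v2 c1 c2|h X1 sh v1 c1|||].
- by rewrite (cov_derivDl omegaP BP) // c1 c2 addr0.
- by rewrite (cov_derivZl omegaP BP) // c1 mulr0.
- by rewrite comb1E cov0m.
- by rewrite comb2E cov0m.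
- by rewrite comb3E cov0m.
Qed.
End BottFrame.

(** * The theorem *)

Theorem theorem2p13 (R : realType) (alpha beta eta : R)
    (heta : eta = 1 \/ eta = -1)
    (G : lieGroupType R 3)
    (Gconn : connected [set: G]) (Gsc : simply_connected R G)
    (g : operator G R -> operator G R -> G -> R)
    (gLor : lorentzian_metric g) (gInv : left_invariant_metric g)
    (e1 e2 e3 : operator G R) (ebasis : lie_algebra_basis e1 e2 e3)
    (eortho : forall p : G, orthonormal_at g e1 e2 e3 p)
    (e12 : bracket e1 e2 = - e2 + (2 * eta - beta) *: e3)
    (e13 : bracket e1 e3 = - beta *: e2 + e3)
    (e23 : bracket e2 e3 = alpha *: e1)
    (nablaL : operator G R -> operator G R -> operator G R)
    (hL : levi_civita g nablaL)
    (piD piD' : operator G R -> operator G R)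
    (hpi : projections (span2 e1 e2) (span1 e3) piD piD')
    (nablaB : operator G R -> operator G R -> operator G R)
    (hB : bott_connection (span2 e1 e2) (span1 e3) piD piD' nablaL nablaB) :
  codazzi nablaB (sym_ricci g nablaB e1 e2 e3) <-> (alpha = 0 /\ beta = 0).
Proof.
have [[ve1 _] [ve2 _] [ve3 _] _] := ebasis.
have gP : symmetric_tensor g := gLor.1.
apply: (codazzi_iff ve1 ve2 ve3 gP eortho hpi hL
  (gamma := 2 * eta - beta)) hB _.
- by rewrite e12 /comb scale0r add0r scaleN1r.
- by rewrite e13 /comb scale0r add0r scale1r.
- by rewrite e23 /comb !scale0r !addr0.
- exact: 1%g.
Qed.
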